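(* No strong Gurariĭ space is weakly Lindelöf determined.
   Context: All Banach spaces are real; isometric embeddings are always linear. A Banach space $X$ is a strong Gurariĭ space if for every pair of finite-dimensional Banach spaces $S\subseteq T$ and every isometric embedding $f\colon S\to X$ there exists an isometric embedding $g\colon T\to X$ with $g\restriction S=f$. A Banach space $X$ is weakly Lindelöf determined if there are a set $\Gamma$ and a one-to-one linear operator from $X^*$ into $\Sigma(\Gamma)=\{x\in\mathbb{R}^\Gamma : |\{\gamma : x(\gamma)\neq 0\}|\leq\aleph_0\}$ that is continuous with respect to the weak-star topology on $X^*$ and the product topology on $\Sigma(\Gamma)$. *)

(* Defs.v *)
From HB Require Import structures.
From mathcomp Require Import all_boot all_order all_algebra.
From mathcomp Require Import all_classical all_reals all_analysis.

Set Implicit Arguments.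
Unset Strict Implicit.
Unset Printing Implicit Defensive.

Import Order.TTheory GRing.Theory Num.Theory.
Import numFieldNormedType.Exports.

Local Open Scope classical_set_scope.
Local Open Scope ring_scope.

#[short(type="finDimBanachType")]
HB.structure Definition FinDimBanach (R : realType) :=
  {T of CompleteNormedModule R T & Vector R T}.

(* A subspace S of T is a [{vspace T}]; its vectors form the type
   [subvs_of S], included in T by [vsval], whose norm is the one of T. *)
Definition strong_gurarii (R : realType) (X : completeNormedModType R) : Prop :=
  forall (T : finDimBanachType R) (S : {vspace T})
         (f : {linear subvs_of S -> X}),
    (forall s : subvs_of S, `|f s| = `|vsval s|) ->
    exists g : {linear T -> X},
      (forall t : T, `|g t| = `|t|) /\
      (forall s : subvs_of S, g (vsval s) = f s).

Section Dual.
Variables (R : realType) (X : normedModType R).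

Definition dual_pred : {pred (X -> R^o)} :=
  [pred f : X -> R^o | `[< linear f /\ continuous f >]].

Record dual : Type :=
  Dual { dual_fun :> X -> R^o ; dual_funP : dual_fun \in dual_pred }.

HB.instance Definition _ := [isSub for dual_fun].
HB.instance Definition _ := [Choice of dual by <:].

Lemma dual_submod_closed : submod_closed dual_pred.
Proof.
split.
  apply/asboolP; split; first by move=> a x y; rewrite /= scaler0 addr0.
  by move=> x; exact: cvg_cst.
move=> a f g /asboolP[lf cf] /asboolP[lg cg]; apply/asboolP; split.
  move=> b x y; rewrite /= !fctE lf lg !scalerDr addrACA !scalerA.
  by rewrite (mulrC a b).
by move=> x; apply: cvgD; [apply: cvgZl_tmp; exact: cf | exact: cg].
Qed.

HB.instance Definition _ :=
  GRing.isSubmodClosed.Build R (X -> R^o) dual_pred dual_submod_closed.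
HB.instance Definition _ := [SubChoice_isSubLmodule of dual by <:].

Definition weak_star : Type :=
  initial_topology (fun f : dual => (f : {ptws X -> R^o})).

HB.instance Definition _ := Topological.on weak_star.

End Dual.

Definition Sigma (R : realType) (Gamma : Type) : set (Gamma -> R^o) :=
  [set x | countable [set gamma | x gamma != 0]].

(* Continuity into [Sigma R Gamma] with the topology induced by the product
   is continuity into the whole product. *)
Definition weakly_lindelof_determined (R : realType)
    (X : completeNormedModType R) : Prop :=
  exists (Gamma : Type) (phi : {linear dual X -> (Gamma -> R^o)}),
    [/\ forall f : dual X, Sigma (phi f),
        injective phi
      & continuous (phi : weak_star X -> {ptws Gamma -> R^o})].

(* Main.v *)
Require Import Defs.
From HB Require Import structures.
From mathcomp Require Import all_boot all_order all_algebra.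
From mathcomp Require Import all_classical all_reals all_analysis.
From mathcomp Require Import ring lra.

Set Implicit Arguments.
Unset Strict Implicit.
Unset Printing Implicit Defensive.

Import Order.TTheory GRing.Theory Num.Theory.
Import numFieldNormedType.Exports.

Local Open Scope classical_set_scope.
Local Open Scope ring_scope.

(** Two incompatible things happen to the unit ball of the dual of [X].

    A strong Gurarii space is full of jumps.  Let [Q] be the space of
    polynomials of degree at most 2 with the supremum norm over [0, 1], and
    for [0 < t < 1] let [T_t] be the span of [Q] and of the function [y_t]
    equal to [-1] up to [t] and to [1] after [t], with the same norm.  Embed
    [Q] isometrically into [X]; by Hahn-Banach the evaluation at each [u] in
    (0, 1) extends to a functional [F u] in the dual ball.  Embed also [T_t],
    extending the embedding of [Q], and let [e t] be the image of [y_t].  The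
    value of [F u] at [e t] is then forced to lie beyond that of the jump
    function: it is at least [1] for [u > t] and at most [-1] for [u < t].
    Indeed a downward parabola [q] with a high and narrow peak at [u > t]
    satisfies [|y_t - q| <= q(u) - 1] ([jump_peak]), whence
    [F u (e t) >= F u q - |e t - q| >= 1].  This is
    [strong_gurarii_jump_system].

    In a weakly Lindelof determined space this is impossible.  The functionals
    [F u] with [u] rational have, all together, a countable set [C] of
    nonzero coordinates.  On the part of the dual ball supported in [C], which
    is weak-star compact, finitely many coordinates control the value at a
    given vector ([small_coordinates]): for each [t] there is [n] such that a
    functional there whose first [n] coordinates are at most [1 / (n + 1)] has
    absolute value less than [1] at [e t].  Fix [n], and take [u] rational.  By compactness the dual ball is
    covered by finitely many cells on which the first [n] coordinates
    oscillate little; for a [t] served by [n], no cell contains both an [F u]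
    with [u < t] and an [F u] with [u > t].  Hence the set of cells visited by
    the [F u] with [u > t] determines [t], and [n] serves only countably many
    [t].  As every [t] in (0, 1) is served by some [n], the interval would be
    countable ([no_jump_system]). *)

(** * Extension of functionals *)
Definition sublinear (R : realType) (V : lmodType R) (q : V -> R) : Prop :=
  (forall x y, q (x + y) <= q x + q y) /\
  (forall (t : R) x, 0 <= t -> q (t *: x) <= t * q x).

Section Sublinear.
Variables (R : realType) (V : lmodType R).
Implicit Types (q p : V -> R) (x y v w : V).

Lemma sublinear0 q : sublinear q -> q 0 = 0.
Proof.
move=> [qD qZ]; apply/eqP; rewrite eq_le; apply/andP; split.
  by have := qZ 0 0 (lexx _); rewrite scaler0 mul0r.
by have := qD 0 0; rewrite addr0 -subr_ge0 addrK.
Qed.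

Lemma sublinearN q x : sublinear q -> - q (- x) <= q x.
Proof.
move=> qS; rewrite -subr_ge0 opprK -(sublinear0 qS) -{1}(subrr x).
exact: qS.1.
Qed.

(** The infimal convolution of [q] with a convex cone [K] of pairs.  It is the
    only construction behind Hahn-Banach: with the graph of a functional on a
    subspace it forces the prescribed values, and with a ray in direction [y] it
    shows that a minimal [q] is additive along [y]. *)
Lemma sublinear_tilt q (K : V -> R -> Prop) :
  sublinear q -> K 0 0 ->
  (forall v a w b, K v a -> K w b -> K (v + w) (a + b)) ->
  (forall t v a, 0 < t -> K v a -> K (t *: v) (t * a)) ->
  (forall v a, K v a -> 0 <= q v + a) ->
  exists2 q', sublinear q' &
    forall v a x, K v a -> q' x <= q (x + v) + a.
Proof.
move=> qS K0 KD KZ Kq.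
pose E x := [set r | exists v a, K v a /\ r = q (x + v) + a].
have E0 x : E x !=set0 by exists (q (x + 0) + 0), 0, 0.
have Elb x : lbound (E x) (- q (- x)).
  move=> _ [v [a [Kva ->]]].
  have := qS.1 (x + v) (- x); rewrite addrAC subrr add0r => h.
  by have := Kq _ _ Kva; lra.
have Einf x v a : K v a -> inf (E x) <= q (x + v) + a.
  move=> Kva; apply: ge_inf; first by exists (- q (- x)); exact: Elb.
  by exists v, a.
exists (fun x => inf (E x)) => [|v a x]; last exact: Einf.
split=> [x y|t x t0].
  rewrite -lerBlDr; apply: lb_le_inf => // _ [v [a [Kva ->]]].
  rewrite lerBlDr -lerBlDl.
  apply: lb_le_inf => // _ [w [b [Kwb ->]]].
  rewrite lerBlDl; apply: le_trans (Einf _ _ _ (KD _ _ _ _ Kwb Kva)) _.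
  have := qS.1 (x + v) (y + w); rewrite addrACA (addrC v w); lra.
have [->|tn0] := eqVneq t 0.
  rewrite scale0r mul0r; apply: le_trans (Einf _ _ _ K0) _.
  by rewrite !addr0 (sublinear0 qS).
have tp : 0 < t by rewrite lt_def tn0.
rewrite -ler_pdivrMl//; apply: lb_le_inf => // _ [v [a [Kva ->]]].
rewrite ler_pdivrMl//; apply: le_trans (Einf _ _ _ (KZ _ _ _ tp Kva)) _.
rewrite -scalerDr mulrDr lerD2r; exact: qS.2.
Qed.

(** Zorn's lemma applies because [- p (- x)] bounds from below, at [x], every
    sublinear functional under [p], so that chains have pointwise infima. *)
Lemma minimal_sublinear p : sublinear p ->
  exists q, [/\ sublinear q, forall x, q x <= p x &
    forall q', sublinear q' -> (forall x, q' x <= q x) -> q' = q].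
Proof.
move=> pS.
pose T := {q : V -> R | sublinear q /\ forall x, q x <= p x}.
pose rel (s t : T) := `[< forall x, sval t x <= sval s x >].
have [|||A Atot|t tmin] := @Zorn T rel.
- by move=> t; apply/asboolP.
- move=> r s t /asboolP rs /asboolP st; apply/asboolP => x.
  exact: le_trans (st x) (rs x).
- move=> [s sP] [t tP] /asboolP/= st /asboolP/= ts; apply: eq_exist.
  by apply/funext => x; apply/eqP; rewrite eq_le st ts.
- have [->|/set0P[a Aa]] := eqVneq A set0.
    by exists (exist _ p (conj pS (fun x => lexx (p x)))).
  pose E x := [set sval s x | s in A].
  have E0 x : E x !=set0 by exists (sval a x), a.
  have Elb x : lbound (E x) (- p (- x)).
    move=> _ [s As <-]; apply: le_trans (sublinearN x (svalP s).1).
    rewrite lerN2; exact: (svalP s).2.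
  have Einf x s : A s -> inf (E x) <= sval s x.
    move=> As; apply: ge_inf; first by exists (- p (- x)); exact: Elb.
    by exists s.
  have iS : sublinear (fun x => inf (E x)).
    split=> [x y|u x u0].
      rewrite -lerBlDr; apply: lb_le_inf => // _ [s As <-].
      rewrite lerBlDr -lerBlDl; apply: lb_le_inf => // _ [r Ar <-].
      rewrite lerBlDl.
      have [/asboolP sr|/asboolP rs] := Atot s r As Ar.
      + apply: le_trans (Einf _ _ Ar) _.
        apply: le_trans ((svalP r).1.1 x y) _.
        by rewrite lerD2r; exact: sr.
      + apply: le_trans (Einf _ _ As) _.
        apply: le_trans ((svalP s).1.1 x y) _.
        by rewrite lerD2l; exact: rs.
    have [->|un0] := eqVneq u 0.
      apply: le_trans (Einf _ _ Aa) _.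
      by rewrite scale0r mul0r (sublinear0 (svalP a).1).
    have up : 0 < u by rewrite lt_def un0.
    rewrite -ler_pdivrMl//; apply: lb_le_inf => // _ [s As <-].
    rewrite ler_pdivrMl//; apply: le_trans (Einf _ _ As) _.
    exact: (svalP s).1.2.
  have ip x : inf (E x) <= p x.
    exact: le_trans (Einf _ _ Aa) ((svalP a).2 x).
  pose i : T := exist _ (fun x => inf (E x)) (conj iS ip).
  by exists i => s As; apply/asboolP => x; exact: Einf.
exists (sval t); split; [exact: (svalP t).1|exact: (svalP t).2|].
move=> q' q'S q't.
have q'p x : q' x <= p x by apply: le_trans (q't x) ((svalP t).2 x).
have := tmin (exist _ q' (conj q'S q'p)).
by move=> <- //; apply/asboolP.
Qed.

(** Tilting [q] along the ray from [0] to [(y, - q y)] gives a sublinear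
    functional below [q], hence [q] itself; evaluating the tilt at the point
    [y] of the ray reads [q x <= q (x + y) - q y]. *)
Lemma minimal_sublinear_linear q : sublinear q ->
  (forall q', sublinear q' -> (forall x, q' x <= q x) -> q' = q) ->
  linear (q : V -> R^o).
Proof.
move=> qS qmin.
have qD x y : q (x + y) = q x + q y.
  apply/eqP; rewrite eq_le qS.1 /=.
  pose K v a := exists2 t : R, 0 <= t & v = t *: y /\ a = - (t * q y).
  have [||||q' q'S q'K] := @sublinear_tilt q K qS.
  - by exists 0 => //; rewrite scale0r mul0r oppr0.
  - move=> v a w b [t t0 [-> ->]] [s s0 [-> ->]].
    by exists (t + s); rewrite ?addr_ge0// scalerDl mulrDl opprD.
  - move=> s v a s0 [t t0 [-> ->]].
    by exists (s * t); rewrite ?mulr_ge0// ?(ltW s0)// scalerA mulrN mulrA.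
  - move=> v a [t t0 [-> ->]].
    have [->|tn0] := eqVneq t 0.
      by rewrite scale0r mul0r (sublinear0 qS) subr0.
    have tp : 0 < t by rewrite lt_def tn0.
    have := qS.2 t^-1 (t *: y); rewrite invr_ge0 t0 => /(_ isT).
    by rewrite scalerA mulVf// scale1r ler_pdivlMl// subr_ge0.
  have q'q : q' = q.
    apply: qmin => // x'; have := q'K 0 0 x'.
    by rewrite !addr0; apply; exists 0; rewrite ?scale0r ?mul0r ?oppr0.
  have : K y (- q y) by exists 1; rewrite ?scale1r ?mul1r.
  by move=> /(q'K _ _ x); rewrite q'q lerBrDr.
have qN x : q (- x) = - q x.
  by apply/eqP; rewrite -addr_eq0 -qD addNr (sublinear0 qS).
have qZp t x : 0 <= t -> q (t *: x) = t * q x.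
  move=> t0; apply/eqP; rewrite eq_le qS.2//=.
  have := qS.2 t (- x) t0; rewrite scalerN !qN; lra.
move=> a x y; rewrite qD; congr (_ + _).
have [a0|a0] := leP 0 a; first exact: qZp.
have := qZp (- a) x; rewrite scaleNr qN mulNr => /(_ _)/oppr_inj; apply.
by rewrite oppr_ge0 ltW.
Qed.

End Sublinear.

Lemma bounded_linear_dual (R : realType) (X : normedModType R) (f : X -> R^o) :
  linear f -> (forall x, f x <= `|x|) -> f \in @dual_pred R X.
Proof.
move=> fl fb; apply/asboolP; split=> //.
pose fL := GRing.isLinear.Build _ _ _ _ f fl.
pose g : {linear X -> R^o} := HB.pack f fL.
apply: (@bounded_linear_continuous _ _ _ g); apply/linear_boundedP.
exists 1; split=> // M M1 x.
apply: (@le_trans _ _ `|x|); last by rewrite ler_peMl// ltW.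
rewrite ler_norml; apply/andP; split; last exact: fb.
by rewrite lerNl -linearN -(normrN x); exact: fb.
Qed.

(** Stated for a functional on the source of an operator rather than on a
    subspace of [X]: the bound makes [a] vanish on the kernel of [j], so it
    factors through the image. *)
Lemma hahn_banach (R : realType) (X : normedModType R) (E : lmodType R)
    (j : {linear E -> X}) (a : {linear E -> R^o}) :
  (forall s, `|a s| <= `|j s|) ->
  exists F : dual X, (forall x, `|F x| <= `|x|) /\ (forall s, F (j s) = a s).
Proof.
move=> aj.
have nS : sublinear (fun x : X => `|x|).
  by split=> [x y|t x t0]; [exact: ler_normD|rewrite normrZ ger0_norm].
pose K v c := exists s, v = - j s /\ c = a s.
have [||||p pS pK] := @sublinear_tilt _ _ _ K nS.
- by exists 0; rewrite !linear0 ?oppr0.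
- move=> v b w c [s [-> ->]] [t [-> ->]]; exists (s + t).
  by rewrite !linearD ?opprD.
- move=> t v b t0 [s [-> ->]]; exists (t *: s).
  by rewrite !linearZ_LR -?scalerN.
- move=> v b [s [-> ->]]; rewrite normrN.
  by have := aj s; rewrite ler_norml => /andP[]; lra.
have [q [qS qp /(minimal_sublinear_linear qS) ql]] := minimal_sublinear pS.
have qn x : q x <= `|x|.
  apply: le_trans (qp x) _; rewrite -[`|x|]addr0 -[in X in `|X|](addr0 x).
  by apply: pK; exists 0; rewrite !linear0 ?oppr0.
have qa s : q (j s) <= a s.
  apply: le_trans (qp _) _; rewrite -[a s]add0r -(normr0 X) -(subrr (j s)).
  by apply: pK; exists s.
pose F := Dual (bounded_linear_dual ql qn).
have FN x : q (- x) = - q x.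
  have := ql (- 1) x 0; rewrite addr0 scaleN1r (sublinear0 qS) => ->.
  by rewrite addr0 scaleN1r.
exists F; split=> [x|s] /=.
  by rewrite ler_norml qn andbT lerNl -FN -(normrN x) qn.
apply/eqP; rewrite eq_le qa /= -lerN2 -FN -linearN.
by rewrite -[X in _ <= X]linearN qa.
Qed.

(** * Weak-star compactness of the dual ball *)
Section WeakStar.
Variables (R : realType) (X : completeNormedModType R).

Definition dual_ball : set (weak_star X) :=
  [set F : dual X | forall x, `|F x| <= `|x|].

Lemma dual_eval_continuous (x : X) :
  continuous ((fun F : dual X => F x) : weak_star X -> R^o).
Proof.
move=> F; apply: (@continuous_comp _ _ _
  ((fun F : dual X => F : {ptws X -> R^o}) : weak_star X -> {ptws X -> R^o})
  (fun g : {ptws X -> R^o} => g x : R^o)).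
  exact: initial_continuous.
exact: proj_continuous.
Qed.

(** In the product topology the linear functions with [|g x| <= |x|] form a
    closed subset of a product of segments.  Linearity and the bound imply
    continuity, so every cluster point comes from an element of the dual. *)
Lemma dual_ball_compact : compact dual_ball.
Proof.
pose L : set {ptws X -> R^o} := [set g | linear g /\ forall x, `|g x| <= `|x|].
have Lc : compact L.
  have -> : L =
      [set g | forall x, (`[- `|x|, `|x|]%classic : set R^o) (g x)] `&`
      \bigcap_(z in @setT (R * X * X))
        [set g | g (z.1.1 *: z.1.2 + z.2) - (z.1.1 * g z.1.2 + g z.2) = 0].
    apply/seteqP; split=> g /=.
      move=> [gl gb]; split=> [x|[[a x] y] _ /=].
        by rewrite /= in_itv /= -ler_norml.
      by rewrite gl subrr.
    move=> [gb gl]; split=> [a x y|x].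
      by apply/eqP; rewrite -subr_eq0; apply/eqP; exact: (gl (a, x, y)).
    by have := gb x; rewrite /= in_itv /= -ler_norml.
  apply: compact_closedI.
    apply: (@tychonoff X (fun=> R^o) (fun x => `[- `|x|, `|x|]%classic)).
    by move=> x; exact: segment_compact.
  apply: closed_bigI => -[[a x] y] _ /=.
  have pc (z : X) : continuous (fun g : {ptws X -> R^o} => g z : R^o).
    exact: proj_continuous.
  apply: (@preimage_closed {ptws X -> R^o} R^o _ [set 0]).
    2: exact: closed_eq.
  move=> g _.
  apply: (@cvgB R R^o _ (nbhs g) _ (fun t => t (a *: x + y))
    (fun t => a * t x + t y)); first exact: pc.
  apply: (@cvgD R R^o _ (nbhs g) _ (fun t => a * t x) (fun t => t y)).
    by apply: (@cvgMl_tmp R _ (nbhs g) _ (fun t => t x)); exact: pc.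
  exact: pc.
move=> F FF FK.
pose i : weak_star X -> {ptws X -> R^o} := fun F : dual X => F.
have FL : (i @ F) L.
  rewrite /fmap /=; apply: filterS FK => G GK; split; last exact: GK.
  by have /asboolP[] := dual_funP G.
have [g [[gl gb] gcl]] := Lc (i @ F) _ FL.
have gle x : g x <= `|x| by apply: le_trans (gb x); exact: ler_norm.
exists (Dual (bounded_linear_dual gl gle)); split; first exact: gb.
move=> A B FA [_ [[V Vo <-] Vg] VB].
have [|_ [[G AG <-] VG]] := gcl (i @` A) V _ (open_nbhs_nbhs (conj Vo Vg)).
  by rewrite /fmap /=; apply: filterS FA => G AG; exists G.
by exists G; split=> //; apply: VB.
Qed.

End WeakStar.

(** * Finite-dimensional Banach spaces from a norm on row vectors *)
Record rV_norm (R : realType) (n : nat) := RVNorm {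
  rV_norm_fun :> 'rV[R]_n -> R ;
  rV_normD : forall x y, rV_norm_fun (x + y) <= rV_norm_fun x + rV_norm_fun y ;
  rV_normZ : forall (a : R) x, rV_norm_fun (a *: x) = `|a| * rV_norm_fun x ;
  rV_norm_eq0 : forall x, rV_norm_fun x = 0 -> x = 0 }.

Section RVNormEquivalence.
Variables (R : realType) (n : nat) (N : rV_norm R n).

Lemma rV_norm0 : N 0 = 0.
Proof. by rewrite -(scale0r 0) rV_normZ normr0 mul0r. Qed.

Lemma rV_normN x : N (- x) = N x.
Proof. by rewrite -scaleN1r rV_normZ normrN1 mul1r. Qed.

Lemma rV_norm_ge0 x : 0 <= N x.
Proof.
have := rV_normD N x (- x).
by rewrite subrr rV_norm0 rV_normN -mulr2n pmulrn_lge0.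
Qed.

Lemma rV_norm_le : exists2 C : R, 0 < C & forall x, N x <= C * `|x|.
Proof.
have Nsum (I : Type) (r : seq I) (F : I -> 'rV[R]_n) :
    N (\sum_(i <- r) F i) <= \sum_(i <- r) N (F i).
  elim: r => [|i r IH]; first by rewrite !big_nil rV_norm0.
  by rewrite !big_cons; apply: le_trans (rV_normD N _ _) _; rewrite lerD2l.
exists (1 + \sum_(i < n) N (delta_mx 0 i)).
  by rewrite ltr_wpDr// sumr_ge0// => i _; exact: rV_norm_ge0.
move=> x; rewrite [in N x](row_sum_delta x).
apply: (le_trans (Nsum _ _ _)).
rewrite mulrDl mul1r ler_wpDl// mulr_suml; apply: ler_sum => i _.
rewrite rV_normZ mulrC ler_wpM2l ?rV_norm_ge0//.
rewrite [leRHS]/Num.norm/= mx_normrE; apply/bigmax_geP; right => /=.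
by exists (ord0, i).
Qed.

Lemma rV_norm_continuous : continuous (N : 'rV[R]_n -> R).
Proof.
have [C C0 NC] := rV_norm_le; move=> x.
apply/(@cvgrPdist_le _ _ _ _ (nbhs_filter (x : 'rV[R]_n))) => e e0.
near=> y; apply: (@le_trans _ _ (N (x - y))).
  have h1 : N x <= N (x - y) + N y by rewrite -{1}(subrK y x); exact: rV_normD.
  have h2 : N y <= N (x - y) + N x.
    by rewrite -(rV_normN (x - y)) opprB -{1}(subrK x y); exact: rV_normD.
  by rewrite ler_norml; apply/andP; split; lra.
apply: le_trans (NC _) _; rewrite mulrC -ler_pdivlMr//.
near: y; apply: cvgr_dist_le; [exact: cvg_id|exact: divr_gt0].
Unshelve. all: by end_near. Qed.

(** The minimum of [N] over the compact unit sphere of the maximum norm. *)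
Lemma rV_norm_ge : exists2 c : R, 0 < c & forall x, c * `|x| <= N x.
Proof.
pose S := [set x : 'rV[R]_n | `|x| = 1].
(* The sphere is empty in dimension 0. *)
have [S0|/set0P S0] := eqVneq S set0.
  exists 1 => // x; have [->|xn0] := eqVneq x 0.
    by rewrite normr0 mulr0 rV_norm0.
  have : S (`|x|^-1 *: x).
    by rewrite /S/= normrZ normfV normr_id mulVf// normr_eq0.
  by rewrite S0.
have Sc : compact S.
  apply: bounded_closed_compact.
    by exists 1; split=> // M M1 x /= ->; exact: ltW.
  apply: (@preimage_closed _ _ (fun x : 'rV[R]_n => `|x|) [set 1]).
    by move=> x _; exact: norm_continuous.
  exact: closed_eq.
have [|c Sc1 cmin] := @compact_EVT_min _ R N S S0 Sc.
  exact/continuous_subspaceT/rV_norm_continuous.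
exists (N c) => [|x].
  rewrite lt_def rV_norm_ge0 andbT; apply/eqP => /rV_norm_eq0 c0.
  by move: Sc1; rewrite inE /S/= c0 normr0 => /eqP; rewrite eq_sym oner_eq0.
have [->|xn0] := eqVneq x 0; first by rewrite normr0 mulr0 rV_norm_ge0.
have xp : 0 < `|x| by rewrite normr_gt0.
rewrite -ler_pdivlMr// mulrC -[X in X * N x]gtr0_norm ?invr_gt0// -rV_normZ.
apply: cmin; rewrite inE /S/= normrZ normfV normr_id mulVf// normr_eq0//.
Qed.

End RVNormEquivalence.

(** An alias of the type of row vectors that carries the topology of [N]
    instead of that of the maximum norm. *)
Definition normed_rV (R : realType) (n : nat) (N : rV_norm R n) := 'rV[R]_n.

Section NormedRV.
Variables (R : realType) (n : nat) (N : rV_norm R n).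

HB.instance Definition _ := Vector.copy (normed_rV N) 'rV[R]_n.
HB.instance Definition _ := Lmodule_isNormed.Build R (normed_rV N)
  (rV_normD N) (rV_normZ N) (@rV_norm_eq0 R n N).

Lemma normed_rV_complete (F : set_system (normed_rV N)) :
  ProperFilter F -> cauchy F -> cvg F.
Proof.
have [C C0 NC] := rV_norm_le N; have [c c0 cN] := rV_norm_ge N.
move=> FF /cauchy_ballP Fc; pose G : set_system 'rV[R]_n := F.
have : cvg G.
  apply: cauchy_cvg; apply/cauchy_ballP => e e0.
  rewrite near_simpl; apply: filterS (Fc (c * e) (mulr_gt0 c0 e0)).
  move=> [x y] /=; rewrite -ball_normE => xy.
  suff : ball_ Num.norm (x : 'rV[R]_n) e y by rewrite ball_normE.
  by rewrite /ball_ /= -(ltr_pM2l c0); exact: le_lt_trans (cN _) xy.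
move=> /cvg_ex[l Gl]; apply/cvg_ex; exists l; apply/cvgrPdist_lt => e e0.
have Gle : G [set x | `|l - x| < e / C].
  by move/cvgrPdist_lt: Gl; apply; exact: divr_gt0.
apply: (@filterS _ F _ _ _ _ Gle) => x /= lx.
rewrite -[ltLHS]/(N (l - x)); apply: le_lt_trans (NC _) _.
by rewrite mulrC -ltr_pdivlMr.
Qed.

HB.instance Definition _ :=
  Uniform_isComplete.Build (normed_rV N) normed_rV_complete.

End NormedRV.

(** * Quadratic polynomials with a jump *)
Section Jump.
Variable R : realType.
Implicit Types (t u v : R) (p q : 'rV[R]_4).

Definition jump t v : R := if t < v then 1 else -1.

(** A row vector is read as a quadratic polynomial plus a multiple of the
    jump function; [jump_eval t p v] is the value at [v]. *)
Definition jump_eval t p v : R :=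
  p 0 0 + p 0 1 * v + p 0 2 * v ^+ 2 + p 0 3 * jump t v.

Lemma normr_jump t v : `|jump t v| = 1.
Proof. by rewrite /jump; case: ifP; rewrite ?normrN normr1. Qed.

Lemma jump_evalD t p q v :
  jump_eval t (p + q) v = jump_eval t p v + jump_eval t q v.
Proof. rewrite /jump_eval !mxE; ring. Qed.

Lemma jump_evalZ t a p v : jump_eval t (a *: p) v = a * jump_eval t p v.
Proof. rewrite /jump_eval !mxE; ring. Qed.

Lemma jump_eval_linear t v : linear (fun p => jump_eval t p v : R^o).
Proof. by move=> a p q; rewrite jump_evalD jump_evalZ. Qed.

Definition jump_norm t p : R :=
  sup [set `|jump_eval t p v| | v in [set v | 0 <= v <= 1]].

Lemma jump_norm_le t p M :
  (forall v, 0 <= v <= 1 -> `|jump_eval t p v| <= M) -> jump_norm t p <= M.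
Proof.
move=> pM; apply: ge_sup => [|_ [v v01 <-]]; last exact: pM.
by exists `|jump_eval t p 0|, 0 => //=; rewrite lexx ler01.
Qed.

Lemma jump_norm_ge t p v :
  0 <= v <= 1 -> `|jump_eval t p v| <= jump_norm t p.
Proof.
move=> v01; apply: ub_le_sup; last by exists v.
exists (`|p 0 0| + `|p 0 1| + `|p 0 2| + `|p 0 3|) => _ [w /= /andP[w0 w1] <-].
apply: le_trans (ler_normD _ _) _; apply: lerD; last first.
  by rewrite normrM normr_jump mulr1.
apply: le_trans (ler_normD _ _) _; apply: lerD; last first.
  by rewrite normrM ler_piMr// ger0_norm ?exprn_ge0// exprn_ile1.
apply: le_trans (ler_normD _ _) _; apply: lerD => //.
by rewrite normrM ler_piMr// ger0_norm.
Qed.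

Lemma jump_normD t p q : jump_norm t (p + q) <= jump_norm t p + jump_norm t q.
Proof.
apply: jump_norm_le => v v01.
rewrite jump_evalD; apply: le_trans (ler_normD _ _) _.
by apply: lerD; exact: jump_norm_ge.
Qed.

Lemma jump_normZ t a p : jump_norm t (a *: p) = `|a| * jump_norm t p.
Proof.
have le b q : jump_norm t (b *: q) <= `|b| * jump_norm t q.
  apply: jump_norm_le => v v01.
  by rewrite jump_evalZ normrM ler_wpM2l//; exact: jump_norm_ge.
apply/eqP; rewrite eq_le le/=.
have [->|a0] := eqVneq a 0.
  rewrite normr0 mul0r scale0r; apply: le_trans (jump_norm_ge t 0 (v := 0) _).
    exact: normr_ge0.
  by rewrite lexx ler01.
have := le a^-1 (a *: p); rewrite scalerA mulVf// scale1r normfV.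
by rewrite ler_pdivlMl// normr_gt0.
Qed.

(** Left of [t] the function is a quadratic polynomial vanishing at
    [0], [t / 2] and [t]; right of [t] the value at [1] then kills the jump. *)
Lemma jump_norm_eq0 t p : 0 < t < 1 -> jump_norm t p = 0 -> p = 0.
Proof.
move=> /andP[t0 t1] Np.
have ev v : 0 <= v <= 1 -> jump_eval t p v = 0.
  move=> v01; apply/eqP; rewrite -normr_le0 -Np; exact: jump_norm_ge.
have low v : 0 <= v -> v <= t -> p 0 0 + p 0 1 * v + p 0 2 * v ^+ 2 = p 0 3.
  move=> v0 vt; have := ev v; rewrite v0 (le_trans vt (ltW t1)) => /(_ isT).
  by rewrite /jump_eval /jump ltNge vt/=; lra.
have := low 0 (lexx _) (ltW t0).
have t20 : 0 <= t / 2 by lra.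
have t2t : t / 2 <= t by lra.
have := low (t / 2) t20 t2t.
have := low t (ltW t0) (lexx _).
have := ev 1; rewrite ler01 lexx => /(_ isT); rewrite /jump_eval /jump t1.
rewrite expr0n/= expr1n !mulr1 !mulr0 !addr0 => e1 et eh e0.
have p2 : p 0 2 = 0.
  apply/eqP; have /eqP : p 0 2 * t ^+ 2 = 0.
    rewrite expr_div_n in eh; move: eh et; set a := p 0 1 * t.
    rewrite mulrA -/a; lra.
  by rewrite mulf_eq0 expf_eq0 (gt_eqF t0) orbF.
have p1 : p 0 1 = 0.
  apply/eqP; have /eqP : p 0 1 * t = 0 by move: et; rewrite p2; lra.
  by rewrite mulf_eq0 (gt_eqF t0) orbF.
have p3 : p 0 3 = 0 by lra.
have p0 : p 0 0 = 0 by lra.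
apply/rowP => i; rewrite mxE; case: i => -[|[|[|[|//]]]] i4.
- by rewrite -[RHS]p0; congr (p _ _); exact: val_inj.
- by rewrite -[RHS]p1; congr (p _ _); exact: val_inj.
- by rewrite -[RHS]p2; congr (p _ _); exact: val_inj.
- by rewrite -[RHS]p3; congr (p _ _); exact: val_inj.
Qed.

Definition jump_rV_norm t (t01 : 0 < t < 1) : rV_norm R 4 :=
  RVNorm (jump_normD t) (jump_normZ t) (fun p => @jump_norm_eq0 t p t01).

(** On polynomials nothing depends on [t]: the spaces for different jumps share
    the subspace of quadratic polynomials isometrically. *)
Lemma jump_eval_quadratic t u q v :
  q 0 3 = 0 -> jump_eval t q v = jump_eval u q v.
Proof. by move=> q3; rewrite /jump_eval q3 !mul0r. Qed.

Lemma jump_norm_quadratic t u q : q 0 3 = 0 -> jump_norm t q = jump_norm u q.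
Proof.
move=> q3; apply/eqP; rewrite eq_le; apply/andP; split;
  apply: jump_norm_le => v v01.
- by rewrite (jump_eval_quadratic t u)//; exact: jump_norm_ge.
- by rewrite (jump_eval_quadratic u t)//; exact: jump_norm_ge.
Qed.

(** The parabola [r - k (v - u) ^ 2], up to the sign of the jump function at
    [u].  On the side of [t] where [u] lies it differs from the jump function by
    at most [r - 1] because of its peak value [r]; on the other side the
    jump function has the wrong sign, and the parabola must have dropped by 2,
    the size of the jump, at [v = t]: this gives [k].  The choice of [r] keeps
    the parabola from becoming too negative on [0, 1]. *)
Lemma jump_peak t u : 0 <= t <= 1 -> 0 <= u <= 1 -> t != u ->
  exists q : 'rV[R]_4, q 0 3 = 0 /\
    jump_norm t (delta_mx 0 3 - q) <= jump t u * jump_eval t q u - 1.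
Proof.
move=> t01 u01 tu.
pose k := 2 / (u - t) ^+ 2; pose r := k + 2.
have ut2 : 0 < (u - t) ^+ 2 by rewrite exprn_even_gt0//= subr_eq0 eq_sym.
have k0 : 0 <= k by rewrite divr_ge0// ltW.
have kut : k * (u - t) ^+ 2 = 2 by rewrite divfK// gt_eqF.
have jj : jump t u * jump t u = 1 by rewrite /jump; case: ifP; lra.
pose q : 'rV[R]_4 := \row_(i < 4)
  [:: jump t u * (r - k * u ^+ 2); jump t u * (2 * k * u);
      - jump t u * k; 0]`_i.
have qE v : jump_eval t q v = jump t u * (r - k * (v - u) ^+ 2).
  rewrite /jump_eval /q !mxE /=; ring.
exists q; split; first by rewrite mxE.
have -> : jump t u * jump_eval t q u = r.
  by rewrite qE subrr expr0n/= mulr0 subr0 mulrA jj mul1r.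
apply: jump_norm_le => v v01.
have -> : jump_eval t (delta_mx 0 3 - q) v =
    jump t v - jump t u * (r - k * (v - u) ^+ 2).
  rewrite -qE /jump_eval !mxE /=; ring.
have vu0 : 0 <= (v - u) ^+ 2 by exact: sqr_ge0.
have vu1 : (v - u) ^+ 2 <= 1.
  by move: v01 u01 => /andP[? ?] /andP[? ?]; nra.
have kvu : k * (v - u) ^+ 2 <= k by rewrite ler_piMr.
have kvu0 : 0 <= k * (v - u) ^+ 2 by exact: mulr_ge0.
have far : (t < v) != (t < u) -> 2 <= k * (v - u) ^+ 2.
  rewrite -kut => tvu; rewrite ler_wpM2l//.
  by move: tvu; case: ltP => tv; case: ltP => tu' //= _; nra.
rewrite ler_norml; apply/andP; rewrite /jump.
move: far; case: (ltP t v) => tv; case: (ltP t u) => tu' /= far; split.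
all: try have {}far := far isT; rewrite /r; lra.
Qed.

End Jump.

(** * Jumps in a strong Gurarii space *)
Section JumpSystem.
Variables (R : realType) (X : completeNormedModType R).

Definition jump_coef t (t01 : 0 < t < 1) (p : normed_rV (jump_rV_norm t01)) :
  R^o := (p : 'rV[R]_4) 0 3.

Lemma jump_coef_linear t (t01 : 0 < t < 1) : linear (@jump_coef t t01).
Proof. by move=> a p q; rewrite /jump_coef !mxE. Qed.

HB.instance Definition _ t (t01 : 0 < t < 1) :=
  GRing.isLinear.Build R (normed_rV (jump_rV_norm t01)) R^o _ (@jump_coef t t01)
    (@jump_coef_linear t t01).

Definition quadratics t (t01 : 0 < t < 1) :
  {vspace normed_rV (jump_rV_norm t01)} := lker (linfun (@jump_coef t t01)).

Lemma mem_quadratics t (t01 : 0 < t < 1) (p : normed_rV (jump_rV_norm t01)) :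
  (p \in quadratics t01) = ((p : 'rV[R]_4) 0 3 == 0).
Proof. by rewrite memv_ker lfunE. Qed.

Lemma strong_gurarii_embed (T : finDimBanachType R) : strong_gurarii X ->
  exists g : {linear T -> X}, forall t, `|g t| = `|t|.
Proof.
move=> XG.
have [|g [gn _]] := XG T 0%VS \0; last by exists g.
by move=> s; have := valP s; rewrite memv0 => /eqP /= ->; rewrite !normr0.
Qed.

(** The vectors [e t] are seen by the functionals [F u] as functions of [u]
    that jump, at [t], from at most [-1] to at least [1]. *)
Definition jump_system (F : R -> dual X) (e : R -> X) : Prop :=
  (forall u, 0 < u < 1 -> forall x, `|F u x| <= `|x|) /\
  (forall t u, 0 < t < 1 -> 0 < u < 1 -> t != u -> 1 <= jump t u * F u (e t)).

(** The quadratic polynomials are embedded once, inside the jump space at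
    [1 / 2], so that the functionals [F u] do not depend on [t]. *)
Lemma strong_gurarii_jump_system : strong_gurarii X ->
  exists F e, jump_system F e.
Proof.
move=> XG.
have h01 : 0 < (2^-1 : R) < 1 by lra.
pose h : R := 2^-1.
have [g gn] := strong_gurarii_embed (normed_rV (jump_rV_norm h01)) XG.
have {}gn (p : 'rV[R]_4) : `|g p| = jump_norm h p by exact: gn.
have Fex u : exists F : dual X, 0 < u < 1 ->
    (forall x, `|F x| <= `|x|) /\ forall p, F (g p) = jump_eval h p u.
  have [u01|_] := boolP (0 < u < 1); last by exists 0.
  pose aL := GRing.isLinear.Build R (normed_rV (jump_rV_norm h01)) R^o _
    (fun p => jump_eval h p u) (@jump_eval_linear R h u).
  pose a : {linear normed_rV (jump_rV_norm h01) -> R^o} :=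
    HB.pack (fun p => jump_eval h p u) aL.
  have [|F [Fn Fg]] := @hahn_banach _ _ _ g a.
    move=> p; rewrite gn; apply: jump_norm_ge.
    by case/andP: u01 => u0 u1; rewrite !ltW.
  by exists F.
have eex t : exists e : X, 0 < t < 1 -> forall q : 'rV[R]_4, q 0 3 = 0 ->
    `|e - g q| = jump_norm t (delta_mx 0 3 - q).
  have [t01|_] := boolP (0 < t < 1); last by exists 0.
  pose fS (s : subvs_of (quadratics t01)) : X := g (vsval s : 'rV[R]_4).
  have fSl : linear fS.
    by move=> a x y; rewrite /fS !linearP.
  pose fL := GRing.isLinear.Build R _ X _ fS fSl.
  pose f : {linear subvs_of (quadratics t01) -> X} := HB.pack fS fL.
  have [|k [kn kf]] := XG _ (quadratics t01) f.
    move=> s; rewrite /= /fS gn; apply: jump_norm_quadratic.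
    by have := subvsP s; rewrite mem_quadratics => /eqP.
  exists (k (delta_mx 0 3 : 'rV[R]_4)) => _ q q3.
  have qS : (q : normed_rV (jump_rV_norm t01)) \in quadratics t01.
    by rewrite mem_quadratics q3.
  have <- : k q = g q.
    by have := kf (Subvs qS); rewrite /= /fS /=.
  by rewrite -linearB kn.
have [F FP] := choice Fex; have [e eP] := choice eex.
exists F, e; split=> [u u01 x|t u t01 u01 tu]; first exact: (FP u u01).1.
have [Fn Fg] := FP u u01.
have [||q [q3 qN]] := @jump_peak R t u _ _ tu.
- by case/andP: t01 => ? ?; rewrite !ltW.
- by case/andP: u01 => ? ?; rewrite !ltW.
have : `|F u (e t - g q)| <= jump_norm t (delta_mx 0 3 - q).
  by rewrite -(eP t t01 q q3); exact: Fn.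
have /asboolP[Fl _] := dual_funP (F u).
have -> : F u (e t - g q) = F u (e t) - jump_eval t q u.
  rewrite (jump_eval_quadratic t h)// -Fg.
  by rewrite [e t - _]addrC -scaleN1r Fl scaleN1r addrC.
move: qN; rewrite /jump; case: ifP => _ qN; rewrite ler_norml => /andP[]; lra.
Qed.

End JumpSystem.

(** * No jumps in a weakly Lindelof determined space *)
HB.instance Definition _ (R : realType) (X : normedModType R) :=
  isPointed.Build (weak_star X) (0 : dual X).

Section WLD.
Variables (R : realType) (X : completeNormedModType R).
Variables (Gamma : Type) (phi : {linear dual X -> (Gamma -> R^o)}).
Hypothesis phi_inj : injective phi.
Hypothesis phi_cont : continuous (phi : weak_star X -> {ptws Gamma -> R^o}).

Lemma coordinate_continuous (gamma : Gamma) :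
  continuous ((fun H : dual X => phi H gamma) : weak_star X -> R^o).
Proof.
move=> H; apply: (@continuous_comp _ _ _
  (phi : weak_star X -> {ptws Gamma -> R^o})
  (fun g : {ptws Gamma -> R^o} => g gamma : R^o)).
  exact: phi_cont.
exact: (@proj_continuous {classic Gamma} (fun=> R^o) gamma).
Qed.

(** Otherwise there would be, for each [n], a functional in the ball,
    supported in [C], whose coordinates of index below [n] are at most
    [1 / (n + 1)], but of size at least [1] at [x]; a weak-star cluster
    point would have all coordinates zero, hence vanish, yet have size at least
    [1] at [x]. *)
Lemma small_coordinates (C : set Gamma) (idx : Gamma -> nat) (x : X) :
  exists n : nat, forall H : dual X, dual_ball H ->
    (forall gamma, ~ C gamma -> phi H gamma = 0) ->
    (forall gamma, C gamma -> (idx gamma < n)%N ->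
      `|phi H gamma| <= n.+1%:R^-1) ->
    `|H x| < 1.
Proof.
apply: contrapT => /forallNP nobound.
have /choice[H HP] (n : nat) : exists H : dual X, [/\ dual_ball H,
    forall gamma, ~ C gamma -> phi H gamma = 0,
    forall gamma, C gamma -> (idx gamma < n)%N -> `|phi H gamma| <= n.+1%:R^-1 &
    1 <= `|H x|].
  have /existsNP[H] := nobound n.
  move=> /not_implyP[Hb /not_implyP[H0 /not_implyP[Hs Hx]]].
  by exists H; split=> //; rewrite leNgt; apply/negP.
pose G : set_system (weak_star X) := H @ \oo.
have [|K [Kb Kcl]] := @dual_ball_compact R X G _.
  by exists 0%N => // n _; have [] := HP n.
have lim (D : set (weak_star X)) (N : nat) : closed D ->
    (forall n, (N <= n)%N -> D (H n)) -> D K.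
  move=> Dcl DH; apply: Dcl => B KB; apply: Kcl KB.
  by exists N => // n /= Nn; exact: DH.
have K0 : phi K = 0.
  apply/funext => gamma; have [Cg|nCg] := pselect (C gamma); last first.
    apply: (lim [set L | phi L gamma = 0] 0%N).
      apply: (@preimage_closed _ _ _ [set 0]); last exact: closed_eq.
      by move=> L _; exact: coordinate_continuous.
    by move=> n _; have [_ + _ _] := HP n; apply.
  apply/eqP; rewrite -normr_le0; apply/ler_addgt0Pl => eps eps0; rewrite addr0.
  have [N Neps] : exists N : nat, N.+1%:R^-1 <= eps.
    have [N _ /(_ N (leqnn _))/=] := near_infty_natSinv_lt (PosNum eps0).
    by move=> /ltW; exists N.
  apply: (lim [set L | `|phi L gamma| <= eps] (maxn N (idx gamma).+1)).
    apply: (@preimage_closed _ _ _ [set r | r <= eps]); last exact: closed_le.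
    move=> L _; apply: (@continuous_comp _ _ _ _ (@Num.norm R R^o)).
      exact: coordinate_continuous.
    exact: norm_continuous.
  move=> n; rewrite geq_max => /andP[Nn idn].
  have [_ _ /(_ gamma Cg idn) + _] := HP n.
  move=> /le_trans; apply; apply: le_trans Neps.
  by rewrite lef_pV2 ?posrE// ler_nat ltnS.
have {K0}K0 : K = 0 by apply: phi_inj; rewrite K0 linear0.
have : 1 <= `|(K : dual X) x|.
  apply: (lim [set L | 1 <= `|(L : dual X) x|] 0%N).
    apply: (@preimage_closed (weak_star X) R (fun L : dual X => `|L x|)
      [set r | 1 <= r]); last exact: closed_ge.
    move=> L _; apply: (@continuous_comp (weak_star X) R^o R
      (fun L : dual X => L x) (@Num.norm R R^o)).
      exact: dual_eval_continuous.
    exact: norm_continuous.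
  by move=> n _; have [] := HP n.
by rewrite K0 normr0 ler10.
Qed.

Definition coordinate_cell (C : set Gamma) (idx : Gamma -> nat) (n : nat)
    (H : dual X) : set (weak_star X) :=
  [set K | forall gamma, C gamma -> (idx gamma < n)%N ->
    `|phi H gamma - phi K gamma| < n.+1%:R^-1].

(** By injectivity of [idx], only finitely many coordinates are constrained. *)
Lemma coordinate_cell_nbhs C idx n (H : dual X) : {in C &, injective idx} ->
  nbhs (H : weak_star X) (coordinate_cell C idx n H).
Proof.
move=> idx_inj; have FF := nbhs_filter (H : weak_star X).
have cell_i (i : 'I_n) : nbhs (H : weak_star X) [set K : dual X |
    forall gamma, C gamma -> idx gamma = i ->
    `|phi H gamma - phi K gamma| < n.+1%:R^-1].
  have [[g [Cg gi]]|noi] := pselect (exists g, C g /\ idx g = i); last first.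
    apply: (@filterS _ _ FF setT _ _ filterT) => K _ g Cg gi.
    by exfalso; apply: noi; exists g.
  have /cvgrPdist_lt/(_ n.+1%:R^-1) := @coordinate_continuous g H.
  rewrite invr_gt0 ltr0n => /(_ isT).
  apply: (@filterS _ _ FF) => K Kg g' Cg' g'i.
  by have -> : g' = g by apply: idx_inj; rewrite ?inE// gi g'i.
have := @filter_forall _ _ _ _ FF cell_i.
apply: (@filterS _ _ FF) => K HK gamma Cg idn.
exact: (HK (Ordinal idn)).
Qed.

(** If [F q] and [F r] lie in one cell with [q < t < r], then
    [(F r - F q) / 2] is a member of the ball with small coordinates and of
    size at least [1] at [e t]. *)
Lemma no_jump_system (F : R -> dual X) (e : R -> X) :
  (forall f : dual X, Sigma (phi f)) -> ~ jump_system F e.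
Proof.
move=> phi_sigma [Fb Fe].
pose C := \bigcup_(q in [set: rat]) [set g | phi (F (ratr q)) g != 0].
have /countable_injP[idx idx_inj] : countable C.
  by apply: bigcup_countable => // q _; exact: phi_sigma.
have FC (q : rat) g : ~ C g -> phi (F (ratr q)) g = 0.
  by apply: contra_notP => /eqP Fqg; exists q.
pose separated n t := forall H : dual X, dual_ball H ->
    (forall gamma, ~ C gamma -> phi H gamma = 0) ->
    (forall gamma, C gamma -> (idx gamma < n)%N ->
      `|phi H gamma| <= n.+1%:R^-1) ->
    `|H (e t)| < 1.
pose T n := [set t | 0 < t < 1 /\ separated n t].
have Tcount n : countable (T n).
  have := @dual_ball_compact R X; rewrite compact_cover.
  move=> /(_ (weak_star X) (@dual_ball R X)
    (fun H => interior (coordinate_cell C idx n H))) [].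
  - by move=> H _; exact: open_interior.
  - by move=> H Hb; exists H => //; exact: coordinate_cell_nbhs.
  move=> D _ cover.
  (* The cells are listed by [D]; the colour of [t] records which of them
     contain a functional [F q] with [q] rational above [t]. *)
  pose above (t : R) (i : dual X) := `[< exists q : rat,
    [/\ 0 < (ratr q : R) < 1, t < ratr q &
    coordinate_cell C idx n i (F (ratr q))] >].
  pose color t : seq bool := [seq above t i | i <- finmap.enum_fset D].
  have color_lt s t : T n s -> T n t -> s < t -> color s != color t.
    move=> [/andP[s0 s1] _] [/andP[t0 t1] tsep] st; apply/eqP => /eq_in_map cst.
    (* The cell of [F q], with [q] between [s] and [t], distinguishes the
       colours: another [F r] in it with [r] above [t] cannot exist. *)
    have [q /[!in_itv]/= /andP[sq qt]] := rat_in_itvoo st.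
    have q01 : 0 < (ratr q : R) < 1.
      by rewrite (lt_trans s0 sq) (lt_trans qt t1).
    have [i Di /interior_subset iq] := cover (F (ratr q)) (Fb _ q01).
    have : above s i by apply/asboolP; exists q; split.
    rewrite (cst i Di) => /asboolP[r [r01 tr ir]].
    have Fq : F (ratr q) (e t) <= -1.
      have := Fe t (ratr q); rewrite t0 t1 q01 /jump (gt_eqF qt) (lt_gtF qt).
      by move=> /(_ isT isT isT); lra.
    have Fr : 1 <= F (ratr r) (e t).
      have := Fe t (ratr r); rewrite t0 t1 r01 /jump (lt_eqF tr) tr mul1r.
      exact.
    pose H : dual X := 2^-1 *: (F (ratr r) - F (ratr q)).
    have Hx x : H x = 2^-1 * (F (ratr r) x - F (ratr q) x) by [].
    have phiH g : phi H g = 2^-1 * (phi (F (ratr r)) g - phi (F (ratr q)) g).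
      by rewrite /H linearZ_LR linearB.
    have : `|H (e t)| < 1.
      apply: tsep => [x|g Cg|g Cg gn].
      - rewrite Hx normrM ger0_norm// ler_pdivrMl//.
        apply: le_trans (ler_normB _ _) _.
        by rewrite mulr_natl mulr2n lerD// Fb.
      - by rewrite phiH !FC// subrr mulr0.
      - rewrite phiH normrM ger0_norm// ler_pdivrMl//.
        have hq := ltW (iq g Cg gn); have hr := ltW (ir g Cg gn).
        rewrite -(subrKA (phi i g)); apply: le_trans (ler_normD _ _) _.
        by rewrite mulr_natl mulr2n lerD// distrC.
    rewrite ltNge => /negP; apply.
    by rewrite Hx (le_trans _ (ler_norm _))//; lra.
  apply/countable_injP; exists (pickle \o color) => s t /set_mem Ts /set_mem Tt.
  move=> /(pcan_inj pickleK) cst; apply/eqP; move: cst.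
  case: (ltgtP s t) => // st /eqP cst.
    by move: (color_lt s t Ts Tt st); rewrite cst.
  by move: (color_lt t s Tt Ts st); rewrite eq_sym cst.
(* Lebesgue measure shows that the interval is uncountable. *)
have : countable (`]0, 1[%classic : set R).
  apply: (@sub_countable _ _ _ (\bigcup_n T n)); last exact: bigcup_countable.
  apply: subset_card_le => t /= ; rewrite in_itv /= => t01.
  have [n tn] := small_coordinates C idx (e t).
  by exists n.
move/countable_lebesgue_measure0; rewrite lebesgue_measure_itv/= lte_fin ltr01.
by rewrite sube0 => /eqP; rewrite eqe oner_eq0.
Qed.

End WLD.

Theorem corollary5p4 (R : realType) (X : completeNormedModType R) :
  strong_gurarii X -> ~ weakly_lindelof_determined X.
Proof.
move=> /strong_gurarii_jump_system[F [e Fe]].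
move=> [Gamma [phi [phi_sigma phi_inj phi_cont]]].
exact: (no_jump_system phi_inj phi_cont phi_sigma Fe).
Qed.
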